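(* Let $d\geq 1$, let $h:\mathbb{R}^d\to\mathbb{R}\cup\{+\infty\}$ be a closed, proper, convex function, let $\{\lambda_k\}_{k\geq 1}$ be a sequence of step sizes with $\lambda_k>0$, and let $\sigma\in[0,1]$. Let $x_\star\in\operatorname{argmin}_x h(x)$. For any starting point $x_0\in\mathbb{R}^d$ and any $N\geq 1$, all iterates of the method ORI-PPA (defined in the context) with step sizes $\{\lambda_k\}_k$ and parameter $\sigma$ satisfy \[h(x_N)-h(x_\star)\leq \frac{(1+\sigma)\,\|x_0-x_\star\|^2}{4A_N}.\] Furthermore, this bound is tight: for all $\{\lambda_k\}_k$ with $\lambda_k>0$, all $\sigma\in[0,1]$, all integers $d\geq 1$, all $x_0\in\mathbb{R}^d$ and all integers $N\geq 1$, there exist a closed, proper, convex function $h$ on $\mathbb{R}^d$, a point $x_\star\in\operatorname{argmin}_x h(x)$, and iterates of ORI-PPA applied to $h$ from $x_0$, for which this bound is achieved with equality.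
   Context: $\|\cdot\|$ and $\langle\cdot;\cdot\rangle$ denote the Euclidean norm and inner product on $\mathbb{R}^d$; $h^*$ denotes the Fenchel conjugate of $h$. Primal-dual gap: for $\lambda>0$ and $x,v,z\in\mathbb{R}^d$, \[\mathrm{PD}_{\lambda h}(x,v;z):=\Phi_p(x;z)-\Phi_d(v;z),\] where $\Phi_p(x;z)=\lambda h(x)+\tfrac12\|x-z\|^2$ and $\Phi_d(v;z)=-\lambda h^*(v)-\tfrac12\|\lambda v-z\|^2+\tfrac12\|z\|^2$. Equivalently, $\mathrm{PD}_{\lambda h}(x,v;z)=\lambda h(x)+\lambda h^*(v)-\lambda\langle x;v\rangle+\tfrac12\|x-z+\lambda v\|^2$. Method ORI-PPA (optimized relatively inexact proximal point algorithm). Input: $h$, $x_0\in\mathbb{R}^d$, $\sigma\in[0,1]$, step sizes $\{\lambda_k\}_{k\ge1}$. Initialization: $z_0=x_0$, $A_0=0$. For $k=0,1,2,\dots$: \[A_{k+1}=A_k+\frac{\lambda_{k+1}+\sqrt{4\lambda_{k+1}A_k+\lambda_{k+1}^2}}{2},\] \[y_k=x_k+\frac{\lambda_{k+1}}{A_{k+1}-A_k}(z_k-x_k),\] then $(x_{k+1},g_{k+1})\in\mathbb{R}^d\times\mathbb{R}^d$ is any pair (an approximation of the exact primal-dual proximal pair at $y_k$) satisfying \[\mathrm{PD}_{\lambda_{k+1}h}(x_{k+1},g_{k+1};y_k)\leq\frac{\sigma^2}{2}\|x_{k+1}-y_k\|^2,\] and \[z_{k+1}=z_k-\frac{2(A_{k+1}-A_k)}{1+\sigma}\,g_{k+1}.\]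 ''Iterates of ORI-PPA'' means any sequences satisfying these relations; the pair $(x_{k+1},g_{k+1})$ is in general not uniquely determined. *)

(* Defs.v *)
From mathcomp Require Import all_boot all_order all_algebra.
From mathcomp Require Import all_classical all_reals all_analysis.

Set Implicit Arguments.
Unset Strict Implicit.
Unset Printing Implicit Defensive.

Import Order.TTheory GRing.Theory Num.Theory.
Import numFieldNormedType.Exports.

Local Open Scope classical_set_scope.
Local Open Scope ring_scope.

Section Euclidean.
Context {R : realType} {d : nat}.
Implicit Types u v : 'rV[R]_d.

Definition dot u v : R := \sum_(i < d) u 0 i * v 0 i.

(* The library norm `|u| on matrices is the sup norm, hence this definition. *)
Definition enorm u : R := Num.sqrt (dot u u).

End Euclidean.

Section ConvexFunctions.
Context {R : realType} {d : nat}.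
Implicit Types (h : 'rV[R]_d -> \bar R) (x v z : 'rV[R]_d).

Definition epigraph h : set ('rV[R]_d * R) := [set p | (h p.1 <= p.2%:E)%E].

Definition closed_fun h : Prop := closed (epigraph h).

Definition proper_fun h : Prop :=
  (forall x, h x != -oo%E) /\ (exists x, h x != +oo%E).

(* Only meaningful when h avoids -oo, so that -oo + +oo does not occur on the
   right-hand side; 0 * +oo = 0 makes the endpoints t = 0 and t = 1 trivial. *)
Definition convex_fun h : Prop :=
  forall x y (t : R), 0 <= t <= 1 ->
    (h (t *: x + (1 - t) *: y)%R <= t%:E * h x + (1 - t)%:E * h y)%E.

Definition argmin h : set 'rV[R]_d := [set x | forall y, (h x <= h y)%E].

Definition fenchel h v : \bar R :=
  ereal_sup [set ((dot v x)%:E - h x)%E | x in [set: 'rV[R]_d]].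

Definition Phi_p h (lam : R) x z : \bar R :=
  (lam%:E * h x + (2^-1 * enorm (x - z) ^+ 2)%:E)%E.

Definition Phi_d h (lam : R) v z : \bar R :=
  (- (lam%:E * fenchel h v)
   - (2^-1 * enorm (lam *: v - z) ^+ 2)%:E
   + (2^-1 * enorm z ^+ 2)%:E)%E.

(* For lam > 0 and h proper, Phi_p > -oo and Phi_d < +oo, so the difference is
   never of the form oo - oo. *)
Definition PD h (lam : R) x v z : \bar R := (Phi_p h lam x z - Phi_d h lam v z)%E.

End ConvexFunctions.

Section ORI_PPA.
Context {R : realType} {d : nat}.

Fixpoint stepA (lam : nat -> R) (k : nat) : R :=
  if k is j.+1 then
    stepA lam j
    + (lam j.+1 + Num.sqrt (4 * lam j.+1 * stepA lam j + lam j.+1 ^+ 2)) / 2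
  else 0.

(* lam 0 and g 0 are never used: both sequences are indexed from 1. *)
Record ori_ppa (h : 'rV[R]_d -> \bar R) (lam : nat -> R) (sigma : R)
    (x0 : 'rV[R]_d) (x g y z : nat -> 'rV[R]_d) : Prop := OriPPA {
  ori_x0 : x 0%N = x0;
  ori_z0 : z 0%N = x0;
  ori_y : forall k, y k = x k
    + (lam k.+1 / (stepA lam k.+1 - stepA lam k)) *: (z k - x k);
  ori_xg : forall k, (PD h (lam k.+1) (x k.+1) (g k.+1) (y k)
    <= (sigma ^+ 2 / 2 * enorm (x k.+1 - y k) ^+ 2)%:E)%E;
  ori_z : forall k, z k.+1 = z k
    - (2 * (stepA lam k.+1 - stepA lam k) / (1 + sigma)) *: g k.+1
}.

End ORI_PPA.

(* Main.v *)
Require Import Defs.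
From mathcomp Require Import all_boot all_order all_algebra.
From mathcomp Require Import all_classical all_reals all_analysis.
From mathcomp Require Import ring lra.

Set Implicit Arguments.
Unset Strict Implicit.
Unset Printing Implicit Defensive.

Import Order.TTheory GRing.Theory Num.Theory.
Import numFieldNormedType.Exports.
Local Open Scope classical_set_scope.
Local Open Scope ring_scope.

(** Write A_k for the weights and a_k = A_{k+1} - A_k.

    Rate.  A small primal-dual gap means two things: g_{k+1} is an
    e-subgradient of h at x_{k+1}, and the residual of the proximal equation
    x_{k+1} - y_k + lam g_{k+1} = 0 is small relative to x_{k+1} - y_k
    ([PD_le_subgradient]).  The weights satisfy a_k^2 = lam_{k+1} A_{k+1}
    ([stepA_quadratic]), so A_{k+1} y_k = A_k x_k + a_k z_k.  Adding the
    e-subgradient inequality at x_k with weight A_k to the one at xstar with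
    weight a_k, and expanding |z_{k+1} - xstar|^2, shows that the potential
      A_k (h(x_k) - h(xstar)) + (1 + sigma) / 4 |z_k - xstar|^2
    increases by at most A_{k+1} times
      e + <g_{k+1}, x_{k+1} - y_k> + lam_{k+1} / (1 + sigma) |g_{k+1}|^2.
    The inexactness criterion makes that quantity nonpositive
    ([inexact_prox_bound]): it controls e + <g, x - y> by squared norms, and
    the triangle inequality gives lam |g| <= (1 + sigma) |x - y|.  Since
    A_0 = 0, the potential starts at (1 + sigma) / 4 |x_0 - xstar|^2.

    Tightness.  All these inequalities are equalities when h is affine between
    x_0 and xstar, each proximal step falls short by the factor 1 / (1 + sigma),
    and z_N lands on xstar.  This happens for h(x) = max(0, <c, x - xstar>) with
    x_0 - xstar = (2 A_N / (1 + sigma)) c: as long as k <= N the iterates are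
      x_k = x_0 - (A_k / (1 + sigma)) c,  z_k = x_0 - (2 A_k / (1 + sigma)) c,
    and x_N, halfway between x_0 and xstar, still lies in the affine region. *)

(** * Euclidean geometry *)

Section EuclideanLemmas.
Context {R : realType} {d : nat}.
Implicit Types (u v w : 'rV[R]_d) (a : R).

Lemma dotC u v : dot u v = dot v u.
Proof. by apply: eq_bigr => i _; rewrite mulrC. Qed.

Lemma dotDr u v w : dot u (v + w) = dot u v + dot u w.
Proof. by rewrite -big_split; apply: eq_bigr => i _; rewrite mxE mulrDr. Qed.

Lemma dotZr a u v : dot u (a *: v) = a * dot u v.
Proof. by rewrite mulr_sumr; apply: eq_bigr => i _; rewrite mxE mulrCA. Qed.

Lemma dotNr u v : dot u (- v) = - dot u v.
Proof. by rewrite -scaleN1r dotZr mulN1r. Qed.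

Lemma dot0r u : dot u 0 = 0.
Proof. by rewrite -(scale0r 0) dotZr mul0r. Qed.

Lemma dotDl u v w : dot (v + w) u = dot v u + dot w u.
Proof. by rewrite ![dot _ u]dotC dotDr. Qed.

Lemma dotZl a u v : dot (a *: v) u = a * dot v u.
Proof. by rewrite ![dot _ u]dotC dotZr. Qed.

Lemma dotNl u v : dot (- v) u = - dot v u.
Proof. by rewrite ![dot _ u]dotC dotNr. Qed.

Definition dotE := (dotDl, dotDr, dotNl, dotNr, dotZl, dotZr).

Lemma dot_ge0 u : 0 <= dot u u.
Proof. by apply: sumr_ge0 => i _; rewrite -expr2 sqr_ge0. Qed.

Lemma enorm_sqr u : enorm u ^+ 2 = dot u u.
Proof. by rewrite sqr_sqrtr ?dot_ge0. Qed.

Lemma dot_eq0 u : dot u u = 0 -> u = 0.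
Proof.
move=> /eqP; rewrite psumr_eq0 => [/allP u0|i _]; last by rewrite -expr2 sqr_ge0.
apply/rowP => i; have := u0 i (mem_index_enum i).
by rewrite mulf_eq0 orbb mxE => /eqP.
Qed.

(** This is the triangle inequality |w| <= |w + u| + |u|, squared so that no
    square root occurs. *)
Lemma dot_le_of_perturb a u w : 0 <= a ->
  dot (u + w) (u + w) <= a ^+ 2 * dot u u ->
  dot w w <= (1 + a) ^+ 2 * dot u u.
Proof.
move=> a0 uw; have [a00|an0] := eqVneq a 0.
  have uw0 : u + w = 0.
    by apply/dot_eq0/le_anti; rewrite dot_ge0 andbT; move: uw; rewrite a00; lra.
  by rewrite -(addr0_eq uw0) !dotE a00; lra.
have a_gt0 : 0 < a by rewrite lt0r an0.
rewrite -(ler_pM2l a_gt0).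
have := dot_ge0 (u + w + a *: u).
have := ler_wpM2l (addr_ge0 ler01 a0) uw.
by rewrite !dotE !(dotC w u); nra.
Qed.

End EuclideanLemmas.

(** * Primal-dual gap and subgradients *)

Section PrimalDualGap.
Context {R : realType} {d : nat}.
Implicit Types (h : 'rV[R]_d -> \bar R) (x v y u : 'rV[R]_d) (lam r : R).

(** The identity behind this is
      PD(x, v; y) = lam (h(x) + fenchel h v - <v, x>) + |x - y + lam v|^2 / 2.
    The first bracket is the e of the conclusion: the Fenchel-Young inequality
    says that it is nonnegative, and bounding fenchel h v from below by
    <v, u> - h(u) says that v is an e-subgradient of h at x. *)
Lemma PD_le_subgradient h lam x v y r : 0 < lam -> proper_fun h ->
  (PD h lam x v y <= r%:E)%E ->
  exists hx e : R, [/\ h x = hx%:E, 0 <= e,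
    forall u, ((hx + dot v (u - x) - e)%:E <= h u)%E &
    lam * e + 2^-1 * enorm (x - y + lam *: v) ^+ 2 <= r].
Proof.
move=> lam0 [hNy [u0 hu0]]; rewrite /PD /Phi_p /Phi_d.
have supP u : ((dot v u)%:E - h u <= fenchel h v)%E.
  by apply: ereal_sup_ubound; exists u.
have FNy : fenchel h v != -oo%E.
  have := supP u0; case: (h u0) (hNy u0) hu0 => // r0 _ _.
  by case: (fenchel h v).
case hxE : (h x) (hNy x) => [hx| |] // _; last first.
  by rewrite gt0_muley ?lte_fin //; case: (fenchel h v) FNy => [f| |] //= _;
     rewrite ?gt0_muley ?lte_fin.
case FE : (fenchel h v) FNy => [f| |] // _; last by rewrite gt0_muley ?lte_fin.
rewrite -!(EFinM, EFinD, EFinN) lee_fin => PDr.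
exists hx, (hx + f - dot v x); split=> //.
- by have := supP x; rewrite hxE FE -EFinB lee_fin; lra.
- move=> u; have := supP u; rewrite FE.
  case: (h u) (hNy u) => [hu| |] //= _; last by rewrite leey.
  by rewrite -EFinB !lee_fin dotDr dotNr; lra.
- by move: PDr; rewrite !enorm_sqr !dotE !(dotC v x) !(dotC v y) !(dotC y x); lra.
Qed.

(** For an exact subgradient the Fenchel-Young inequality is an equality, so only
    the residual of the proximal equation remains in the gap. *)
Lemma PD_subgradient h lam x v y (hx : R) : 0 < lam -> h x = hx%:E ->
  (forall u, ((hx + dot v (u - x))%:E <= h u)%E) ->
  PD h lam x v y = (2^-1 * enorm (x - y + lam *: v) ^+ 2)%:E.
Proof.
move=> lam0 hxE sub.
have FE : fenchel h v = (dot v x - hx)%:E.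
  apply/eqP; rewrite eq_le; apply/andP; split.
    apply: ge_ereal_sup => _ [u _ <-]; have := sub u.
    case: (h u) => [hu| |] //=; last by rewrite leNye.
    by rewrite -EFinB !lee_fin dotDr dotNr; lra.
  by apply: ereal_sup_ubound; exists x => //; rewrite hxE.
rewrite /PD /Phi_p /Phi_d hxE FE -!(EFinM, EFinD, EFinN); congr EFin.
by rewrite !enorm_sqr !dotE !(dotC v x) !(dotC v y) !(dotC y x); field.
Qed.

End PrimalDualGap.

(** * Convergence rate *)

Section Rate.
Context {R : realType} {d : nat}.
Implicit Types (x y z g u : 'rV[R]_d).

Section Steps.
Variable lam : nat -> R.
Hypothesis lam_gt0 : forall k, (1 <= k)%N -> 0 < lam k.

Lemma stepA_ge0 k : 0 <= stepA lam k.
Proof.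
elim: k => //= k IH; have := lam_gt0 (ltn0Sn k) => l0.
by have := sqrtr_ge0 (4 * lam k.+1 * stepA lam k + lam k.+1 ^+ 2); lra.
Qed.

Lemma stepA_lt k : stepA lam k < stepA lam k.+1.
Proof.
have := lam_gt0 (ltn0Sn k) => /= l0.
by have := sqrtr_ge0 (4 * lam k.+1 * stepA lam k + lam k.+1 ^+ 2); lra.
Qed.

Lemma stepA_gt0 k : (1 <= k)%N -> 0 < stepA lam k.
Proof. by case: k => // k _; apply: le_lt_trans (stepA_ge0 k) (stepA_lt k). Qed.

(** The recursion of the weights is the positive root of this quadratic, and it
    is only through it that the square root enters the analysis. *)
Lemma stepA_quadratic k :
  (stepA lam k.+1 - stepA lam k) ^+ 2 = lam k.+1 * stepA lam k.+1.
Proof.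
have l0 := lam_gt0 (ltn0Sn k); have A0 := stepA_ge0 k.
rewrite /=; set D := 4 * _ * _ + _; have D0 : 0 <= D by rewrite /D; nra.
by have := sqr_sqrtr D0; rewrite {2}/D; lra.
Qed.

End Steps.

(** With D = x - y and G = l g, expanding the criterion bounds l times the left
    side by (1 - sigma) / (2 (1 + sigma)) * (|G|^2 - (1 + sigma)^2 |D|^2).  As
    l e >= 0, the criterion also gives |D + G| <= sigma |D|, whence
    |G| <= (1 + sigma) |D|. *)
Lemma inexact_prox_bound (l sigma e : R) x y g : 0 < l -> 0 <= sigma <= 1 ->
  0 <= e ->
  l * e + 2^-1 * enorm (x - y + l *: g) ^+ 2 <=
    sigma ^+ 2 / 2 * enorm (x - y) ^+ 2 ->
  e + dot g (x - y) + l / (1 + sigma) * dot g g <= 0.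
Proof.
move=> l0 /andP[s0 s1] e0; rewrite !enorm_sqr => E.
have le0 := mulr_ge0 (ltW l0) e0.
have G : dot (l *: g) (l *: g) <= (1 + sigma) ^+ 2 * dot (x - y) (x - y).
  by apply: dot_le_of_perturb => //; lra.
set D := x - y in E G *.
(* Half of the quadratic term completes the square |D + G|^2 / 2; the rest
   carries the factor (1 - sigma) / 2 that matches (1 - sigma^2) / 2 |D|^2. *)
have -> : l / (1 + sigma) * dot g g =
          l * dot g g / 2 + (1 - sigma) / 2 * (l * dot g g / (1 + sigma)).
  by field; lra.
have {}G : l * (l * dot g g / (1 + sigma)) <= (1 + sigma) * dot D D.
  have -> : l * (l * dot g g / (1 + sigma)) =
      dot (l *: g) (l *: g) / (1 + sigma) by rewrite !dotE; ring.
  by rewrite ler_pdivrMr; lra.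
rewrite -(pmulr_rle0 _ l0).
have := ler_wpM2l (_ : 0 <= (1 - sigma) / 2) G; move=> /(_ ltac:(lra)).
by move: E; rewrite /D !dotE !(dotC x g) !(dotC y g); lra.
Qed.

(** One step decreases the potential.  The choice of y cancels the inner products
    of g with x and z, and a^2 = l (A + a) turns the quadratic term of
    |z' - u|^2 into the one of the bound on the inexact proximal step.  The
    inequality at x enters multiplied by A, so that it holds trivially when
    A = 0 and h(x) may be infinite. *)
Lemma lyapunov_step (l A a sigma e Hx Hx' Hu : R) x x' y z z' g u :
  0 < l -> 0 <= A -> 0 < a -> a ^+ 2 = l * (A + a) -> 0 <= sigma <= 1 ->
  y = x + (l / a) *: (z - x) ->
  z' = z - (2 * a / (1 + sigma)) *: g ->
  e + dot g (x' - y) + l / (1 + sigma) * dot g g <= 0 ->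
  Hx' + dot g (u - x') - e <= Hu ->
  A * (Hx' + dot g (x - x') - e) <= A * Hx ->
  (A + a) * (Hx' - Hu) + (1 + sigma) / 4 * enorm (z' - u) ^+ 2 <=
  A * (Hx - Hu) + (1 + sigma) / 4 * enorm (z - u) ^+ 2.
Proof.
move=> l0 A0 a0 aq /andP[s0 s1] yE z'E K Hu_ Hx_.
have gy : (A + a) * dot g y = A * dot g x + a * dot g z.
  have la : (A + a) * (l / a) = a.
    by rewrite mulrA [_ * l]mulrC -aq expr2 mulfK ?gt_eqF.
  rewrite yE !dotE mulrDr mulrA la; ring.
have -> : (1 + sigma) / 4 * enorm (z' - u) ^+ 2 =
  (1 + sigma) / 4 * enorm (z - u) ^+ 2 - a * (dot g z - dot g u)
  + a ^+ 2 / (1 + sigma) * dot g g.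
  rewrite z'E !enorm_sqr !dotE !(dotC z g) !(dotC u g) !(dotC u z); field; lra.
have Aa0 : 0 <= A + a by lra.
have := ler_wpM2l Aa0 K; have := ler_wpM2l (ltW a0) Hu_.
rewrite aq mulr0 !mulrDr -!mulrA.
move: Hx_ gy; rewrite !dotE; lra.
Qed.

Theorem ori_ppa_rate h (lam : nat -> R) (sigma : R) (xstar x0 : 'rV[R]_d) N
    (x g y z : nat -> 'rV[R]_d) :
  proper_fun h -> (forall k, (1 <= k)%N -> 0 < lam k) -> 0 <= sigma <= 1 ->
  argmin h xstar -> (1 <= N)%N -> ori_ppa h lam sigma x0 x g y z ->
  (h (x N) - h xstar
    <= ((1 + sigma) * enorm (x0 - xstar) ^+ 2 / (4 * stepA lam N))%:E)%E.
Proof.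
move=> hp lam0 s01 hmin N1 [xx0 zz0 yE PDle zE].
have step k := PD_le_subgradient (lam0 k.+1 isT) hp (PDle k).
have [hs hsE] : exists r, h xstar = r%:E.
  have [r [e [hr _ _ _]]] := step 0%N; have := hmin (x 1%N); rewrite hr.
  by case: (h xstar) (hp.1 xstar) => [s| |] // _ _; exists s.
pose H k := fine (h (x k)).
have HE k : (1 <= k)%N -> h (x k) = (H k)%:E.
  by case: k => // k _; have [r [e [hr _ _ _]]] := step k; rewrite /H hr.
have decr k : stepA lam k * (H k - hs)
      + (1 + sigma) / 4 * enorm (z k - xstar) ^+ 2
    <= (1 + sigma) / 4 * enorm (x0 - xstar) ^+ 2.
  elim: k => [|k IH]; first by rewrite zz0 /= mul0r add0r.
  apply: le_trans IH.
  have [r [e [hr e0 sub err]]] := step k.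
  have Hr : H k.+1 = r by rewrite /H hr.
  have l0 := lam0 k.+1 isT.
  have A0 := stepA_ge0 lam0 k; have Alt := stepA_lt lam0 k.
  set a := stepA lam k.+1 - stepA lam k.
  have -> : stepA lam k.+1 = stepA lam k + a by rewrite /a addrC subrK.
  apply: (@lyapunov_step (lam k.+1) _ _ _ e _ _ _ _ (x k.+1) (y k) _ _
    (g k.+1)); rewrite /a ?subr_gt0 //.
  - by rewrite stepA_quadratic // addrC subrK.
  - exact: inexact_prox_bound err.
  - by have := sub xstar; rewrite hsE lee_fin Hr.
  - (* For k = 0 the value h (x 0) may be infinite, but its weight vanishes. *)
    case: k A0 sub Hr {Alt err a l0 hr} => [_ _ _|k A0 sub Hr].
      by rewrite !mul0r.
    apply: ler_wpM2l => //.
    by have := sub (x k.+1); rewrite HE // lee_fin Hr.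
have A0 := stepA_gt0 lam0 N1.
rewrite HE // hsE -EFinB lee_fin ler_pdivlMr; last by lra.
have := decr N; have := sqr_ge0 (enorm (z N - xstar)); nra.
Qed.

End Rate.

(** * Tightness *)

Section HingeFunction.
Context {R : realType} {d : nat}.
Implicit Types (c s u x y : 'rV[R]_d).

Definition hinge c s x : \bar R := (Num.max 0 (dot c (x - s)))%:E.

Lemma dot_continuous c : continuous (dot c).
Proof.
apply: continuous_big => [|i _ x]; first exact: add_continuous.
apply: (@cvgM _ _ (nbhs x) _ (cst (c 0 i)) (fun v : 'rV[R]_d => v 0 i)).
  exact: cvg_cst.
exact: coord_continuous.
Qed.

Lemma hinge_closed c s : closed_fun (hinge c s).
Proof.
rewrite /closed_fun.
have -> : epigraph (hinge c s) = snd @^-1` [set r : R | 0 <= r] `&`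
    (fun p => p.2 - dot c (p.1 - s)) @^-1` [set r : R | 0 <= r].
  apply/seteqP; split=> p /=; rewrite /epigraph /= lee_fin ge_max subr_ge0.
    by move=> /andP[].
  by move=> [-> ->].
apply: closedI; apply: preimage_closed; try exact: closed_ge.
  by move=> p _; apply: cvg_snd.
move=> p _; apply: cvgB; first exact: cvg_snd.
apply: (@cvg_comp _ _ _ (fun p : 'rV[R]_d * R => p.1 - s) (dot c));
  last exact: dot_continuous.
by apply: cvgB; [exact: cvg_fst|exact: cvg_cst].
Qed.

Lemma hinge_proper c s : proper_fun (hinge c s).
Proof. by split=> //; exists 0. Qed.

Lemma hinge_convex c s : convex_fun (hinge c s).
Proof.
move=> x y t /andP[t0 t1]; rewrite /hinge -!EFinM -EFinD lee_fin.
have -> : dot c (t *: x + (1 - t) *: y - s) =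
    t * dot c (x - s) + (1 - t) * dot c (y - s) by rewrite !dotE; ring.
have M (a : R) : a <= Num.max 0 a /\ 0 <= Num.max 0 a.
  by rewrite !le_max !lexx orbT.
have [x1 x0] := M (dot c (x - s)); have [y1 y0] := M (dot c (y - s)).
have t1' : 0 <= 1 - t by lra.
have := ler_wpM2l t0 x1; have := ler_wpM2l t1' y1.
have := mulr_ge0 t0 x0; have := mulr_ge0 t1' y0.
by rewrite ge_max; lra.
Qed.

Lemma hinge_argmin c s : argmin (hinge c s) s.
Proof.
move=> x; rewrite /hinge subrr lee_fin.
by rewrite dot0r maxxx le_max lexx.
Qed.

(** The subgradients of the hinge at x are the multiples th c with th in [0, 1]
    that are complementary to x: th = 1 on the open affine side, th = 0 on the
    open flat side, any th on the kink. *)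
Lemma hinge_subgradient c s x (th : R) : 0 <= th <= 1 ->
  th * dot c (x - s) = Num.max 0 (dot c (x - s)) ->
  forall u, ((Num.max 0 (dot c (x - s)) + dot (th *: c) (u - x))%:E
             <= hinge c s u)%E.
Proof.
move=> /andP[th0 th1] <- u; rewrite lee_fin dotZl -mulrDr -dotDr.
have -> : x - s + (u - x) = u - s by rewrite addrC subrKA.
rewrite le_max; have [p0|p0] := leP 0 (dot c (u - s)).
  by rewrite -[X in _ || (_ <= X)]mul1r ler_wpM2r ?orbT.
by rewrite mulr_ge0_le0 // ltW.
Qed.

(** An acceptable proximal pair exists at every point, and the step shortened by
    1 + sigma along c is acceptable whenever it stays on the affine side: its
    residual l c sigma / (1 + sigma) has norm exactly sigma times the length
    of the step.  Elsewhere the exact proximal point is used, so that the method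
    can be continued forever. *)
Lemma hinge_inexact_prox c s (l sigma : R) y : 0 < l -> 0 <= sigma <= 1 ->
  exists p : 'rV[R]_d * 'rV[R]_d,
    (PD (hinge c s) l p.1 p.2 y
      <= (sigma ^+ 2 / 2 * enorm (p.1 - y) ^+ 2)%:E)%E /\
    (0 <= dot c (y - (l / (1 + sigma)) *: c - s) ->
      p = (y - (l / (1 + sigma)) *: c, c)).
Proof.
move=> l0 /[dup] s01 /andP[s0 s1].
have certif (x : 'rV[R]_d) (th : R) : 0 <= th <= 1 ->
    th * dot c (x - s) = Num.max 0 (dot c (x - s)) ->
    enorm (x - y + l *: (th *: c)) ^+ 2 <= sigma ^+ 2 * enorm (x - y) ^+ 2 ->
    (PD (hinge c s) l x (th *: c) y
      <= (sigma ^+ 2 / 2 * enorm (x - y) ^+ 2)%:E)%E.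
  move=> th01 thE res;
    rewrite (PD_subgradient y l0 erefl (hinge_subgradient th01 thE)).
  by rewrite lee_fin; lra.
have exact_step (x : 'rV[R]_d) (th : R) : x - y = - (l *: (th *: c)) ->
    enorm (x - y + l *: (th *: c)) ^+ 2 <= sigma ^+ 2 * enorm (x - y) ^+ 2.
  move=> ->; rewrite addNr !enorm_sqr dot0r.
  by rewrite mulr_ge0 ?sqr_ge0 ?dot_ge0.
set xi := y - _.
have [pos|neg] := leP 0 (dot c (xi - s)).
  exists (xi, c); split=> //=; rewrite -[X in PD _ _ _ X]scale1r.
  apply: certif; rewrite ?ler01 ?lexx // ?mul1r ?max_r //.
  have -> : xi - y = - (l / (1 + sigma)) *: c.
    by rewrite /xi addrAC subrr add0r scaleNr.
  rewrite scale1r -scalerDl !enorm_sqr !dotE le_eqVlt; apply/orP; left; apply/eqP.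
  by field; lra.
have [p0|p0] := leP (dot c (y - s)) 0.
  exists (y, 0 *: c); split=> //=.
  apply: certif; rewrite ?lexx ?ler01 ?mul0r ?max_l //; apply: exact_step.
  by rewrite scale0r scaler0 oppr0 subrr.
(* The remaining points project exactly onto the kink, with th in (0, 1). *)
have q0 : 0 < dot c c.
  rewrite lt0r dot_ge0 andbT; apply: contraTneq p0 => /dot_eq0 ->.
  by rewrite dotC dot0r ltxx.
pose th := dot c (y - s) / (l * dot c c).
have lq0 : 0 < l * dot c c by apply: mulr_gt0.
have thq : th * (l * dot c c) = dot c (y - s) by rewrite divfK ?gt_eqF.
have xE : dot c (y - l *: (th *: c) - s) = 0.
  by move: thq; rewrite !dotE; lra.
exists (y - l *: (th *: c), th *: c); split=> //=.
apply: certif.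
- rewrite /th divr_ge0 ?(ltW p0, ltW lq0) //= ler_pdivrMr // mul1r.
  move: neg; rewrite /xi !dotE.
  have : l / (1 + sigma) <= l by rewrite ler_pdivrMr; nra.
  by move=> /(ler_wpM2r (ltW q0)); lra.
- by rewrite xE mulr0 maxxx.
- by apply: exact_step; rewrite addrAC subrr add0r.
Qed.

End HingeFunction.

Section WorstCase.
Context {R : realType} {d : nat}.

(** A rule answering every query (k, y) with an acceptable pair generates
    iterates; the equation on the pairs lets a caller follow them. *)
Lemma ori_ppa_exists (h : 'rV[R]_d -> \bar R) (lam : nat -> R) (sigma : R) x0
    (f : nat -> 'rV[R]_d -> 'rV[R]_d * 'rV[R]_d) :
  (forall k y, (PD h (lam k.+1) (f k y).1 (f k y).2 y
    <= (sigma ^+ 2 / 2 * enorm ((f k y).1 - y) ^+ 2)%:E)%E) ->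
  exists x g y z, ori_ppa h lam sigma x0 x g y z /\
    forall k, (x k.+1, g k.+1) = f k (y k).
Proof.
move=> fP.
pose pt k (st : 'rV[R]_d * 'rV[R]_d) :=
  st.1 + (lam k.+1 / (stepA lam k.+1 - stepA lam k)) *: (st.2 - st.1).
pose next k st := ((f k (pt k st)).1,
  st.2 - (2 * (stepA lam k.+1 - stepA lam k) / (1 + sigma)) *: (f k (pt k st)).2).
(* st k is the pair (x_k, z_k). *)
pose st := fix st k := if k is j.+1 then next j (st j) else (x0, x0).
exists (fun k => (st k).1), (fun k => (f k.-1 (pt k.-1 (st k.-1))).2),
  (fun k => pt k (st k)), (fun k => (st k).2).
by split=> [|k] /=; [split=> // k; exact: fP | case: (f _ _)].
Qed.

(** Equality is attained for every prescribed minimizer xstar, hence also with a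
    nonzero bound; xstar = x0 gives the degenerate case c = 0. *)
Theorem ori_ppa_rate_tight (lam : nat -> R) (sigma : R) (xstar x0 : 'rV[R]_d) N :
  (forall k, (1 <= k)%N -> 0 < lam k) -> 0 <= sigma <= 1 -> (1 <= N)%N ->
  exists h x g y z,
    closed_fun h /\ proper_fun h /\ convex_fun h /\
    argmin h xstar /\ ori_ppa h lam sigma x0 x g y z /\
    (h (x N) - h xstar
      = ((1 + sigma) * enorm (x0 - xstar) ^+ 2 / (4 * stepA lam N))%:E)%E.
Proof.
move=> lam0 s01 N1; have /andP[s0 s1] := s01.
have AN0 := stepA_gt0 lam0 N1.
have Ale : {homo stepA lam : i j / (i <= j)%N >-> i <= j}.
  by apply: homo_leq => [//|? ? ?|i]; [exact: le_trans | exact/ltW/stepA_lt].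
pose c := ((1 + sigma) / (2 * stepA lam N)) *: (x0 - xstar).
(* The length of c is the one for which z_N = xstar. *)
have x0E : x0 - xstar = (2 * stepA lam N / (1 + sigma)) *: c.
  rewrite scalerA -[LHS]scale1r; congr (_ *: _); field; lra.
have [f fP] := choice (fun ky : nat * 'rV[R]_d =>
  hinge_inexact_prox c xstar ky.2 (lam0 ky.1.+1 isT) s01).
have [x [g [y [z [it fE]]]]] :=
  @ori_ppa_exists _ lam sigma x0 (fun k y => f (k, y)) (fun k y => (fP (k, y)).1).
exists (hinge c xstar), x, g, y, z; split; first exact: hinge_closed.
do 2!(split; first by [exact: hinge_proper | exact: hinge_convex]).
split; first exact: hinge_argmin.
split=> //.
have valE t : dot c (x0 - (t / (1 + sigma)) *: c - xstar) =
    (2 * stepA lam N - t) / (1 + sigma) * dot c c.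
  by rewrite addrAC x0E -scalerBl dotZr; congr (_ * _); field; lra.
have [xx0 zz0 yE _ zE] := it.
have traj k : (k <= N)%N ->
    x k = x0 - (stepA lam k / (1 + sigma)) *: c /\
    z k = x0 - (2 * stepA lam k / (1 + sigma)) *: c.
  elim: k => [_|k IH kN]; first by rewrite xx0 zz0 /= mulr0 mul0r scale0r subr0.
  have [xk zk] := IH (ltnW kN).
  have a0 : 0 < stepA lam k.+1 - stepA lam k by rewrite subr_gt0 stepA_lt.
  have xiE : y k - (lam k.+1 / (1 + sigma)) *: c =
      x0 - (stepA lam k.+1 / (1 + sigma)) *: c.
    have m : lam k.+1 / (stepA lam k.+1 - stepA lam k) * stepA lam k =
        stepA lam k.+1 - stepA lam k - lam k.+1.
      apply: (mulIf (lt0r_neq0 a0)); rewrite mulrAC divfK ?gt_eqF //.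
      by have := stepA_quadratic lam0 k; nra.
    rewrite yE; set w := _ / (_ - _) in m *.
    have -> : stepA lam k.+1 = stepA lam k + w * stepA lam k + lam k.+1.
      by rewrite m; ring.
    by rewrite xk zk; apply/rowP => i; rewrite !mxE; ring.
  (* A_{k+1} <= A_N <= 2 A_N keeps the shortened step on the affine side. *)
  have [xk1 gk1] :
      x k.+1 = x0 - (stepA lam k.+1 / (1 + sigma)) *: c /\ g k.+1 = c.
    have := fE k; rewrite (fP (k, y k)).2 /= ?xiE; first by case.
    rewrite valE mulr_ge0 ?dot_ge0 // divr_ge0; [by []| |lra].
    by have := Ale _ _ kN; lra.
  split=> //; rewrite zE gk1 zk; apply/rowP => i; rewrite !mxE; ring.
have [-> _] := traj N (leqnn N).
rewrite /hinge subrr dot0r maxxx sube0 valE.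
rewrite max_r; last by rewrite mulr_ge0 ?dot_ge0 // divr_ge0; lra.
congr EFin; rewrite enorm_sqr x0E !dotE; field; lra.
Qed.

End WorstCase.

(** * The rate and its tightness *)

Theorem theorem4p1 (R : realType) :
  (forall (d : nat) (h : 'rV[R]_d -> \bar R) (lam : nat -> R) (sigma : R)
      (xstar x0 : 'rV[R]_d) (N : nat) (x g y z : nat -> 'rV[R]_d),
    (1 <= d)%N ->
    closed_fun h -> proper_fun h -> convex_fun h ->
    (forall k, (1 <= k)%N -> 0 < lam k) ->
    0 <= sigma <= 1 ->
    argmin h xstar ->
    (1 <= N)%N ->
    ori_ppa h lam sigma x0 x g y z ->
    (h (x N) - h xstar
      <= ((1 + sigma) * enorm (x0 - xstar) ^+ 2 / (4 * stepA lam N))%:E)%E)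
  /\
  (forall (lam : nat -> R) (sigma : R) (d : nat) (x0 : 'rV[R]_d) (N : nat),
    (forall k, (1 <= k)%N -> 0 < lam k) ->
    0 <= sigma <= 1 ->
    (1 <= d)%N ->
    (1 <= N)%N ->
    exists (h : 'rV[R]_d -> \bar R) (xstar : 'rV[R]_d)
        (x g y z : nat -> 'rV[R]_d),
      closed_fun h /\ proper_fun h /\ convex_fun h /\
      argmin h xstar /\
      ori_ppa h lam sigma x0 x g y z /\
      (h (x N) - h xstar
        = ((1 + sigma) * enorm (x0 - xstar) ^+ 2 / (4 * stepA lam N))%:E)%E).
Proof.
split=> [d h lam sigma xstar x0 N x g y z _ _ hp _ lam0 s01 hmin N1 it
        |lam sigma d x0 N lam0 s01 _ N1].
  exact: (ori_ppa_rate hp lam0 s01 hmin N1 it).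
(* Any minimizer will do; one different from x0 makes the bound nonzero. *)
have [h [x [g [y [z P]]]]] := ori_ppa_rate_tight (x0 - const_mx 1) x0 lam0 s01 N1.
by exists h, (x0 - const_mx 1), x, g, y, z.
Qed.
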